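(* Let $A$ be a (possibly non-unital) $\subseteq_\perp$-Blackadar $*$-ring. Then minimal upper bounds in $\mathcal{P}$ are $\ll$-supremums in $A$: if $Q\subseteq\mathcal{P}$ and $p\in\mathcal{P}$ is minimal with respect to $\ll$ among the elements $p'\in\mathcal{P}$ satisfying $q\ll p'$ for all $q\in Q$, then $$\{a\in A:p\ll a\}=\bigcap_{q\in Q}\{a\in A:q\ll a\}.$$
   Context: A $*$-ring is an associative ring with a map $a\mapsto a^*$ satisfying $a^{**}=a$, $(ab)^*=b^*a^*$, $(a+b)^*=a^*+b^*$. $\mathcal{P}=\{p\in A:p=pp^*\}$ is the set of projections. The relation $\ll$ on $A$ is $a\ll b\Leftrightarrow a=ab$; it is a partial order on $\mathcal{P}$. The relation $\subseteq_\perp$ on $A$ is: $a\subseteq_\perp b\Leftrightarrow$ for all $x\in A$, $bx=0$ implies $ax=0$. $A$ is $\subseteq_\perp$-Blackadar if for every $a\in A\setminus\{0\}$ there is $p\in\mathcal{P}\setminus\{0\}$ with $p\subseteq_\perp a$. An intersection over the empty index set is $A$. *)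

(* Defs.v *)
From HB Require Import structures.
From mathcomp Require Import all_boot all_order all_algebra.
From mathcomp Require Import classical_sets.

Set Implicit Arguments.
Unset Strict Implicit.
Unset Printing Implicit Defensive.

Import GRing.Theory.
Local Open Scope ring_scope.
Local Open Scope classical_set_scope.

Declare Scope rng_scope.
Delimit Scope rng_scope with rng.
Local Open Scope rng_scope.

(* Associative rings that need not have a unit. The multiplication of
   [pzRingType] cannot be reused, because that structure includes 1. *)
HB.mixin Record Zmodule_isRng A of GRing.Zmodule A := {
  rng_mul : A -> A -> A;
  rng_mulA : associative rng_mul;
  rng_mulDl : left_distributive rng_mul +%R;
  rng_mulDr : right_distributive rng_mul +%R
}.

#[short(type="rngType")]
HB.structure Definition Rng := { A of Zmodule_isRng A & GRing.Zmodule A }.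

Notation "a * b" := (rng_mul a b) : rng_scope.

HB.mixin Record Rng_isStarRing A of Rng A := {
  star : A -> A;
  starK : involutive star;
  starM : forall a b : A, star (a * b) = star b * star a;
  starD : {morph star : a b / a + b}
}.

#[short(type="starRingType")]
HB.structure Definition StarRing := { A of Rng_isStarRing A & Rng A }.

Notation "a ^*" := (star a) : rng_scope.

Section StarRingDefs.
Variable A : starRingType.
Implicit Types (a b p q x : A) (Q S : set A).

Definition projections : set A := [set p | p = p * p^*].

Definition below a b : Prop := a = a * b.

Definition subperp a b : Prop := forall x, b * x = 0 -> a * x = 0.

Definition subperp_Blackadar : Prop :=
  forall a, a != 0 ->
    exists p, [/\ projections p, p != 0 & subperp p a].

(* [below] is only a partial order on [projections], so both notions below are
   meant for sets of projections. *)
Definition upper_projections Q : set A :=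
  [set p | projections p /\ forall q, Q q -> below q p].

Definition minimal_in S p : Prop :=
  S p /\ forall p', S p' -> below p' p -> p' = p.

End StarRingDefs.

Arguments projections A : clear implicits.
Arguments subperp_Blackadar A : clear implicits.

Notation "a ≪ b" := (below a b) (at level 70, no associativity) : rng_scope.

(* Main.v *)
Require Import Defs.
From mathcomp Require Import all_boot all_order all_algebra.
From mathcomp Require Import classical_sets.

(** Let [a] satisfy [q ≪ a] for all [q] in [Q], and let [p] be a minimal upper
    projection of [Q]. The defect [b = p - p * a] lies under [p] and is killed
    on the left by every [q] in [Q]. Taking adjoints, [b^*] is killed on the
    right by [Q] and by every [x - p * x]. If [b] were nonzero, a nonzero
    projection [r] with [subperp r b^*] would inherit these annihilations: [r]
    would be orthogonal to [Q] and below [p] ([below_of_rmul_eq] is needed for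
    the latter, because there is no unit to evaluate at). Then [p - r]
    would be a strictly smaller upper projection of [Q], contradicting the
    minimality of [p]. *)

Import GRing.Theory.

Local Open Scope ring_scope.
Local Open Scope classical_set_scope.
Local Open Scope rng_scope.

Lemma rng_mulr0 (A : rngType) (a : A) : a * 0 = 0.
Proof. by apply: (addrI (a * 0)); rewrite -rng_mulDr !addr0. Qed.

Lemma rng_mul0r (A : rngType) (a : A) : 0 * a = 0.
Proof. by apply: (addrI (0 * a)); rewrite -rng_mulDl !addr0. Qed.

Lemma rng_mulrN (A : rngType) (a b : A) : a * (- b) = - (a * b)%rng.
Proof. by apply: (addrI (a * b)); rewrite -rng_mulDr !subrr rng_mulr0. Qed.

Lemma rng_mulNr (A : rngType) (a b : A) : (- a) * b = - (a * b)%rng.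
Proof. by apply: (addrI (a * b)); rewrite -rng_mulDl !subrr rng_mul0r. Qed.

Lemma rng_mulBr (A : rngType) (a b c : A) :
  a * (b - c) = (a * b)%rng - (a * c)%rng.
Proof. by rewrite rng_mulDr rng_mulrN. Qed.

Lemma rng_mulBl (A : rngType) (a b c : A) :
  (b - c) * a = (b * a)%rng - (c * a)%rng.
Proof. by rewrite rng_mulDl rng_mulNr. Qed.

Lemma star0 (A : starRingType) : (0 : A)^* = 0.
Proof. by apply: (addrI ((0 : A)^*)); rewrite -starD !addr0. Qed.

Lemma starB (A : starRingType) (a b : A) : (a - b)^* = a^*%rng - b^*%rng.
Proof. by apply: (addIr (b^*)); rewrite -starD !subrK. Qed.

Lemma projection_star (A : starRingType) (p : A) : projections A p -> p^* = p.
Proof. by move=> pE; rewrite pE starM starK. Qed.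

Lemma projection_idem (A : starRingType) (p : A) : projections A p -> p * p = p.
Proof. by move=> pP; rewrite -{2}(projection_star A p pP) -pP. Qed.

(** A nonzero [y] with [y * A = 0] would dominate a nonzero projection [s],
    and then [s = s * s = 0]. *)
Lemma eq0_of_rmul0 (A : starRingType) (y : A) :
  subperp_Blackadar A -> (forall x, y * x = 0) -> y = 0.
Proof.
move=> hA y0; apply/eqP/negPn/negP => /hA [s [sP /eqP s0 sy]].
by apply: s0; rewrite -(projection_idem A s sP); apply: sy.
Qed.

(** Cancels the common right factor that a unit would otherwise remove. *)
Lemma below_of_rmul_eq (A : starRingType) (r p : A) :
  subperp_Blackadar A -> (forall x, r * x = r * p * x) -> r ≪ p.
Proof.
move=> hA rpx; apply: subr0_eq; apply: (eq0_of_rmul0 A _ hA) => x.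
by rewrite rng_mulBl -rpx subrr.
Qed.

Lemma below_trans (A : starRingType) (a b c : A) : a ≪ b -> b ≪ c -> a ≪ c.
Proof. by rewrite /below => ab bc; rewrite {2}ab -rng_mulA -bc. Qed.

Lemma projection_below_mull (A : starRingType) (r p : A) :
  projections A r -> projections A p -> r ≪ p -> p * r = r.
Proof.
move=> rP pP rp.
by rewrite -(projection_star A r rP) -{1}(projection_star A p pP) -starM -rp.
Qed.

Lemma projectionB (A : starRingType) (p r : A) :
  projections A p -> projections A r -> r ≪ p -> projections A (p - r).
Proof.
move=> pP rP rp; rewrite /projections /= starB !projection_star //.
rewrite rng_mulBr !rng_mulBl !projection_idem //.
by rewrite (projection_below_mull A r p rP pP rp) -rp subrr subr0.
Qed.

(** Otherwise [p - r] would be an upper projection strictly below [p]. *)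
Lemma minimal_upper_orthogonal (A : starRingType) (Q : set A) (p r : A) :
  minimal_in (upper_projections Q) p -> projections A r -> r ≪ p ->
  (forall q, Q q -> q * r = 0) -> r = 0.
Proof.
move=> [[pP Qp] pmin] rP rp Qr.
have pBr : (p - r) = p.
  apply: pmin; last by rewrite /below rng_mulBl (projection_idem A p pP) -rp.
  split=> [|q qQ]; first exact: projectionB.
  by rewrite /below rng_mulBr (Qr q qQ) subr0; apply: Qp.
by rewrite -(subKr p r) pBr subrr.
Qed.

Theorem proposition3 (A : starRingType) (hA : subperp_Blackadar A)
    (Q : set A) (hQ : Q `<=` projections A)
    (p : A) (hp : minimal_in (upper_projections Q) p) :
  [set a : A | p ≪ a] = \bigcap_(q in Q) [set a : A | q ≪ a].
Proof.
have [[pP Qp] _] := hp.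
apply/seteqP; split=> a /= ha.
  by move=> q qQ; apply: (below_trans A _ _ _ (Qp q qQ) ha).
set b := p - (p * a)%rng.
suff b0 : b = 0 by apply: subr0_eq.
have pb : p * b = b by rewrite /b rng_mulBr rng_mulA projection_idem.
have Qb q : Q q -> q * b = 0.
  by move=> qQ; rewrite /b rng_mulBr rng_mulA -(Qp q qQ) -(ha q qQ) subrr.
have bp : b^* * p = b^* by rewrite -{1}(projection_star A p pP) -starM pb.
suff bs0 : b^* = 0 by rewrite -(starK b) bs0 star0.
apply/eqP/negPn/negP => /hA [r [rP /eqP r0 rb]]; apply: r0.
have rp : r ≪ p.
  apply: (below_of_rmul_eq A r p hA) => x; apply: subr0_eq.
  rewrite -rng_mulA -rng_mulBr; apply: rb.
  by rewrite rng_mulBr rng_mulA bp subrr.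
apply: (minimal_upper_orthogonal A Q p r hp rP rp) => q qQ.
have qS := projection_star A q (hQ q qQ).
have rq : r * q = 0 by apply: rb; rewrite -qS -starM (Qb q qQ) star0.
by rewrite -qS -(projection_star A r rP) -starM rq star0.
Qed.
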